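(* Let $\mathcal{C} \subseteq \mathcal{D}$, and let $f,g: K_0^{sp}(\mathcal{D}) \to K_0^{sp}(\mathcal{C})$ be $\mathcal{C}$-barcoding invariants. Then either (i) $f$ and $g$ are incomparable, or (ii) $f = g$.
   Context: $\mathcal{D}$ denotes an essentially small Krull-Schmidt category, i.e. an additive category whose isomorphism classes of objects form a set and in which every object decomposes as a finite direct sum of objects with local endomorphism rings. The notation $\mathcal{C}\subseteq\mathcal{D}$ means that $\mathcal{C}$ is a full subcategory of $\mathcal{D}$ containing the zero object and closed under isomorphisms, (finite) direct sums and direct summands; then $\mathcal{C}$ is also Krull-Schmidt. $\mathrm{ind}(\mathcal{D})$ is the set of isomorphism classes of indecomposable objects of $\mathcal{D}$. The split Grothendieck group $K_0^{sp}(\mathcal{D})$ is the free abelian group generated by isomorphism classes $[M]$ of objects of $\mathcal{D}$ modulo the relations $[M_1\oplus M_2]=[M_1]+[M_2]$; it is free abelian with basis $\mathrm{ind}(\mathcal{D})$. If $\mathcal{C}\subseteq\mathcal{D}$, then $\mathrm{ind}(\mathcal{C})\subseteq\mathrm{ind}(\mathcal{D})$ and $K_0^{sp}(\mathcal{C})$ is regarded as the subgroup of $K_0^{sp}(\mathcal{D})$ generated by $\mathrm{ind}(\mathcal{C})$. An additive invariant on $\mathcal{D}$ is a group homomorphism $f: K_0^{sp}(\mathcal{D})\to G$ for some abelian group $G$. For additive invariants $f,g$ on $\mathcal{D}$ write $f\gtrsim g$ ($f$ is finer than $g$) if $\ker f\subseteq\ker g$. $f$ and $g$ are incomparable if neither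 $f\gtrsim g$ nor $g\gtrsim f$. An additive invariant $f:K_0^{sp}(\mathcal{D})\to K_0^{sp}(\mathcal{C})$ is $\mathcal{C}$-barcoding if $f(c)=c$ for every $c\in K_0^{sp}(\mathcal{C})$. *)

(* Defs.v *)
From Stdlib Require List.
From HB Require Import structures.
From mathcomp Require Import all_boot all_order all_algebra.
From mathcomp Require Import boolp.
From mathcomp Require Import freeg.
Set Implicit Arguments.
Unset Strict Implicit.
Unset Printing Implicit Defensive.
Import GRing.Theory.
Local Open Scope ring_scope.
Local Open Scope quotient_scope.

Record preadditive := Preadditive {
  Ob :> Type;
  Hom : Ob -> Ob -> zmodType;
  idm : forall A, Hom A A;
  comp : forall A B C, Hom B C -> Hom A B -> Hom A C;
  compA : forall A B C E (h : Hom C E) (g : Hom B C) (f : Hom A B),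
    comp h (comp g f) = comp (comp h g) f;
  comp1m : forall A B (f : Hom A B), comp (idm B) f = f;
  compm1 : forall A B (f : Hom A B), comp f (idm A) = f;
  compDl : forall A B C (g g' : Hom B C) (f : Hom A B),
    comp (g + g') f = comp g f + comp g' f;
  compDr : forall A B C (g : Hom B C) (f f' : Hom A B),
    comp g (f + f') = comp g f + comp g f'
}.
Arguments Hom {p}.
Arguments idm {p} A.
Arguments comp {p A B C}.

Section Preadditive.
Variable D : preadditive.
Implicit Types A B C S Z : D.

Definition is_iso A B (f : Hom A B) : Prop :=
  exists2 g : Hom B A, comp g f = idm A & comp f g = idm B.

Definition isomorphic A B : Prop := exists f : Hom A B, is_iso f.

Definition is_zero Z : Prop :=
  forall A, (forall f : Hom A Z, f = 0) /\ (forall f : Hom Z A, f = 0).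

Definition is_dsum A B S : Prop :=
  exists (i1 : Hom A S) (i2 : Hom B S) (p1 : Hom S A) (p2 : Hom S B),
  [/\ comp p1 i1 = idm A, comp p2 i2 = idm B, comp p1 i2 = 0, comp p2 i1 = 0
    & comp i1 p1 + comp i2 p2 = idm S].

Fixpoint is_dsum_seq (s : seq D) S : Prop :=
  if s is A :: s' then exists2 B, is_dsum_seq s' B & is_dsum A B S
  else is_zero S.

(* A ring is local if it is nonzero and the sum of two non-units is a
   non-unit; the units of End(A) are the isomorphisms A -> A. *)
Definition local_End A : Prop :=
  idm A <> 0 /\
  forall f g : Hom A A, ~ is_iso f -> ~ is_iso g -> ~ is_iso (f + g).

Lemma isomorphic_refl A : isomorphic A A.
Proof. by exists (idm A), (idm A); rewrite comp1m. Qed.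

Lemma isomorphic_sym A B : isomorphic A B -> isomorphic B A.
Proof. by case=> f [g gf fg]; exists g, f. Qed.

Lemma isomorphic_trans A B C :
  isomorphic A B -> isomorphic B C -> isomorphic A C.
Proof.
case=> f [f' f'f ff'] [g [g' g'g gg']]; exists (comp g f), (comp f' g').
  by rewrite compA -(compA f') g'g compm1.
by rewrite compA -(compA g) ff' compm1.
Qed.

Lemma is_dsumC A B S : is_dsum A B S -> is_dsum B A S.
Proof.
by case=> i1 [i2 [p1 [p2 [? ? ? ? E]]]]; exists i2, i1, p2, p1; rewrite addrC.
Qed.

Definition isomorphicb : rel {classic Ob D} :=
  fun A B => `[< isomorphic A B >].

Lemma isomorphicb_equiv : equiv_class_of isomorphicb.
Proof.
split=> [A | A B | B A C].
- exact/asboolP/isomorphic_refl.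
- by apply/asboolP/asboolP => /isomorphic_sym.
- by move=> /asboolP AB /asboolP BC; apply/asboolP/(isomorphic_trans AB).
Qed.

Canonical isomorphicb_equiv_rel := EquivRelPack isomorphicb_equiv.

Definition isoclass := {eq_quot isomorphicb}.
HB.instance Definition _ := Choice.on isoclass.
HB.instance Definition _ : EqQuotient _ isomorphicb isoclass :=
  EqQuotient.on isoclass.

Definition iso_cl (A : D) : isoclass := \pi_isoclass (A : {classic Ob D}).

Lemma iso_clP A B : iso_cl A = iso_cl B <-> isomorphic A B.
Proof.
split=> [/eqP | AB]; last apply/eqP.
  by rewrite piE => /asboolP.
by rewrite piE; apply/asboolP.
Qed.

End Preadditive.

Section Subgroup.
Variables (V : zmodType) (P : V -> Prop).

Definition gen_subgroup : {pred V} := fun x =>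
  `[< forall H : zmodClosed V, (forall y, P y -> y \in H) -> x \in H >].

Lemma gen_subgroup_closed : zmod_closed gen_subgroup.
Proof.
split=> [|x y /asboolP Hx /asboolP Hy]; apply/asboolP => H PH.
  exact: rpred0.
by apply: rpredB; [apply: Hx | apply: Hy].
Qed.

HB.instance Definition _ :=
  GRing.isZmodClosed.Build V gen_subgroup gen_subgroup_closed.

Lemma gen_subgroup_mem x : P x -> x \in gen_subgroup.
Proof. by move=> Px; apply/asboolP => H; apply. Qed.

Lemma gen_subgroup_ker (W : zmodType) (phi : {additive V -> W}) :
  (forall x, P x -> phi x = 0) -> forall x, x \in gen_subgroup -> phi x = 0.
Proof.
move=> phiP x /asboolP xP.
pose K : {pred V} := fun x => phi x == 0.
have Kc : zmod_closed K.
  by split=> [|u v]; rewrite !unfold_in ?raddf0 // raddfB => /eqP-> /eqP->;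
     rewrite subrr.
pose H : zmodClosed V := HB.pack K (GRing.isZmodClosed.Build V K Kc).
by apply/eqP; apply: (xP H) => y /phiP yK; rewrite unfold_in /= /K yK.
Qed.

End Subgroup.

(* Being essentially small imposes nothing: the isomorphism classes of D form
   the type [isoclass D]. *)
Record krull_schmidt := KrullSchmidt {
  ks_preadditive :> preadditive;
  ks_zero : exists Z : ks_preadditive, is_zero Z;
  ks_dsum : forall A B : ks_preadditive, exists S, is_dsum A B S;
  ks_decomp : forall S : ks_preadditive,
    exists2 s, List.Forall (@local_End ks_preadditive) s & is_dsum_seq s S
}.

Section SplitGrothendieck.
Variable D : krull_schmidt.

Definition split_relator (x : {freeg (isoclass D)}) : Prop :=
  exists A B S : D, is_dsum A B S /\
    x = << iso_cl S >> - (<< iso_cl A >> + << iso_cl B >>).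

Definition K0sp : zmodType := Quotient.quot (gen_subgroup split_relator).

Definition K0_cl (A : D) : K0sp := \pi_K0sp << iso_cl A >>.

End SplitGrothendieck.

Section K0Theory.
Variable D : krull_schmidt.

Lemma K0_pi_additive : {morph \pi_(K0sp D) : x y / x + y >-> x + y}.
Proof. exact: Quotient.pi_add. Qed.

Lemma K0_cl_iso (A B : D) : isomorphic A B -> K0_cl A = K0_cl B.
Proof. by move=> /iso_clP AB; rewrite /K0_cl AB. Qed.

Lemma K0_cl_dsum (A B S : D) : is_dsum A B S -> K0_cl S = K0_cl A + K0_cl B.
Proof.
move=> dS; rewrite /K0_cl -K0_pi_additive; apply/eqP.
by rewrite -Quotient.idealrBE; apply: gen_subgroup_mem; exists A, B, S.
Qed.

End K0Theory.

(* The notation C \subseteq D.  Closure of [sub_mem] under isomorphisms also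
   follows from the other conditions. *)
Record ks_sub (D : krull_schmidt) := KSSub {
  sub_mem : D -> Prop;
  sub_zero : forall Z, is_zero Z -> sub_mem Z;
  sub_iso : forall A B, isomorphic A B -> sub_mem A -> sub_mem B;
  sub_dsum : forall A B S, is_dsum A B S -> sub_mem A -> sub_mem B -> sub_mem S;
  sub_summand : forall A B S, is_dsum A B S -> sub_mem S -> sub_mem A
}.

Section FullSubcategory.
Variables (D : krull_schmidt) (C : ks_sub D).

Definition full_sub : preadditive :=
  @Preadditive {A : D | sub_mem C A} (fun A B => Hom (sval A) (sval B))
    (fun A => idm (sval A)) (fun A B E => @comp D (sval A) (sval B) (sval E))
    (fun _ _ _ _ h g f => compA h g f) (fun _ _ f => comp1m f)
    (fun _ _ f => compm1 f) (fun _ _ _ g g' f => compDl g g' f)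
    (fun _ _ _ g f f' => compDr g f f').

Lemma full_sub_zero : exists Z : full_sub, is_zero Z.
Proof.
have [Z Z0] := ks_zero D.
by exists (exist _ Z (sub_zero C Z0)) => A; apply: Z0.
Qed.

Lemma full_sub_dsum (A B : full_sub) : exists S, is_dsum A B S.
Proof.
have [S dS] := ks_dsum (sval A) (sval B).
by exists (exist _ S (sub_dsum dS (svalP A) (svalP B))).
Qed.

Lemma full_sub_decomp (S : full_sub) :
  exists2 s, List.Forall (@local_End full_sub) s & is_dsum_seq s S.
Proof.
case: S => S CS; have [s] := ks_decomp S.
elim: s S CS => [|A s IHs] S CS /= locs dS.
  by exists [::] => // A; apply: dS.
inversion_clear locs as [|? ? locA locs'].
case: dS => B /IHs sB dS.
have CA : sub_mem C A := sub_summand dS CS.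
have [t loct dt] := sB (sub_summand (is_dsumC dS) CS) locs'.
exists (exist _ A CA :: t); first by constructor.
by exists (exist _ B (sub_summand (is_dsumC dS) CS)).
Qed.

Definition ks_of_sub : krull_schmidt :=
  KrullSchmidt full_sub_zero full_sub_dsum full_sub_decomp.

End FullSubcategory.

Coercion ks_of_sub : ks_sub >-> krull_schmidt.

(* The map K0sp C -> K0sp D sending the class of an object of C to its class
   in D; it is through this map that K0sp C is regarded as the subgroup of
   K0sp D generated by the indecomposables of C. *)
Section Inclusion.
Variables (D : krull_schmidt) (C : ks_sub D).

Definition incl_isoclass (a : isoclass C) : zmodule (K0sp D) :=
  K0_cl (sval (repr a : Ob C)).

Definition incl_free (x : {freeg (isoclass C)}) : K0sp D :=
  fglift incl_isoclass x.

Lemma incl_free_zmod_morphism : zmod_morphism incl_free.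
Proof. exact: (@lift_is_additive _ _ (zmodule (K0sp D)) incl_isoclass). Qed.
HB.instance Definition _ :=
  GRing.isZmodMorphism.Build _ _ incl_free incl_free_zmod_morphism.

Lemma incl_free_cl (A : C) : incl_free << iso_cl A >> = K0_cl (sval A).
Proof.
rewrite /incl_free liftU scale1r /incl_isoclass; apply: K0_cl_iso.
have /iso_clP [f [g gf fg]] :
  iso_cl (repr (iso_cl A) : Ob C) = iso_cl A by rewrite /iso_cl reprK.
by exists f, g.
Qed.

Lemma incl_free_relator x : x \in gen_subgroup (@split_relator C) ->
  incl_free x = 0.
Proof.
apply: gen_subgroup_ker => {}x [A [B [S [dS ->]]]].
rewrite raddfB raddfD /= !incl_free_cl.
have /K0_cl_dsum -> : is_dsum (sval A) (sval B) (sval S) by [].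
by rewrite subrr.
Qed.

Definition K0_incl (x : K0sp C) : K0sp D := incl_free (repr x).

Lemma K0_incl_pi x : K0_incl (\pi x) = incl_free x.
Proof.
apply/eqP; rewrite -subr_eq0 -raddfB; apply/eqP/incl_free_relator.
by rewrite Quotient.idealrBE reprK.
Qed.

Lemma K0_incl_zmod_morphism : zmod_morphism K0_incl.
Proof.
by move=> x y; rewrite -[x]reprK -[y]reprK -raddfB !K0_incl_pi raddfB.
Qed.
HB.instance Definition _ :=
  GRing.isZmodMorphism.Build _ _ K0_incl K0_incl_zmod_morphism.

Lemma K0_incl_cl (A : C) : K0_incl (K0_cl A) = K0_cl (sval A).
Proof. by rewrite K0_incl_pi incl_free_cl. Qed.

End Inclusion.

Definition additive_invariant (D : krull_schmidt) (G : zmodType) :=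
  {additive K0sp D -> G}.

Definition finer (D : krull_schmidt) (G H : zmodType)
    (f : additive_invariant D G) (g : additive_invariant D H) : Prop :=
  forall x, f x = 0 -> g x = 0.

Definition incomparable (D : krull_schmidt) (G H : zmodType)
    (f : additive_invariant D G) (g : additive_invariant D H) : Prop :=
  ~ finer f g /\ ~ finer g f.

Definition barcoding (D : krull_schmidt) (C : ks_sub D)
    (f : additive_invariant D (K0sp C)) : Prop :=
  forall c : K0sp C, f (K0_incl c) = c.

(* Main.v *)
(** A [C]-barcoding invariant [f] is a retraction onto [K0sp C], so
    [x - f x] lies in [ker f] for every [x]; if [ker f] is contained in [ker g],
    applying [g] gives [g x = g (f x) = f x]. *)
Require Import Defs.
From mathcomp Require Import all_boot all_order all_algebra.
From mathcomp Require Import boolp.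
Import GRing.Theory.
Local Open Scope ring_scope.

(** The kernel of a barcoding invariant is a complement of the copy of [K0sp C] in [K0sp D], and
    nested complements of one subgroup coincide. Hence a single inclusion of kernels, in either
    direction, already forces equality. *)

Lemma barcoding_finer_eq (D : krull_schmidt) (C : ks_sub D)
    (f g : additive_invariant D (K0sp C)) :
  barcoding f -> barcoding g -> finer f g -> f =1 g.
Proof.
move=> fK gK fg x.
have /fg : f (x - K0_incl (f x)) = 0 by rewrite raddfB fK subrr.
by rewrite raddfB gK => /subr0_eq.
Qed.

Theorem theorem3p11 (D : krull_schmidt) (C : ks_sub D)
    (f g : additive_invariant D (K0sp C)) :
  barcoding f -> barcoding g -> incomparable f g \/ f =1 g.
Proof.
move=> fK gK; have [fg | nfg] := EM (f =1 g); [by right | left].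
split=> [fg | gf]; apply: nfg; first exact: barcoding_finer_eq.
(* The lemma is not symmetric in [f] and [g]: here their roles are exchanged, which yields
   [g =1 f]. *)
by move=> x; rewrite (barcoding_finer_eq _ _ _ _ gK fK gf).
Qed.
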